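(* Let $n,k$ be positive integers such that $p=kn+1$ is a strong representative of order $n$. Then, up to renaming of the colors, the map $c(a)=(a^k\bmod p)$, $a\in K_n$, is a multiplicative $n$-satisfactory coloring of $K_n$; that is, there is a bijection $\psi$ from the set $\{(a^k\bmod p):a\in K_n\}$ onto $[n]$ such that $\psi\circ c:K_n\to[n]$ is a multiplicative $n$-satisfactory coloring.
   Context: $[n]=\{1,\dots,n\}$. $K_n$ is the set of positive integers all of whose prime factors are less than or equal to $n$. A strong representative of order $n$ is a prime $p$ of the form $kn+1$, $k$ a positive integer, such that $1^k,\dots,n^k$ are pairwise distinct modulo $p$. An $n$-satisfactory coloring of $K_n$ is a map $c:K_n\to[n]$ with $c(i)=i$ for all $i\in[n]$ and such that for every $a\in K_n$ the colors $c(a),c(2a),\dots,c(na)$ are all different. It is multiplicative if there is an abelian group structure $([n],\oplus)$ on the set $[n]$ such that $c(ab)=c(a)\oplus c(b)$ for all $a,b\in K_n$. *)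

(* Defs.v *)
From mathcomp Require Import all_boot.
From mathcomp Require Import boolp classical_sets functions.

Set Implicit Arguments.
Unset Strict Implicit.
Unset Printing Implicit Defensive.

Local Open Scope classical_set_scope.
Local Open Scope nat_scope.

Definition colors (n : nat) : set nat := [set i | 0 < i <= n].

(* The predicate [pi.-nat a] includes [0 < a]. *)
Definition K (n : nat) : set nat := [set a | [pred q : nat | q <= n].-nat a].

Definition strong_representative (n p : nat) : Prop :=
  prime p /\
  exists k : nat, [/\ 0 < k, p = k * n + 1
    & set_inj (colors n) (fun i => i ^ k %% p)].

(* A coloring of K n is a function on nat of which only the values on K n
   are constrained. *)
Definition satisfactory_coloring (n : nat) (c : nat -> nat) : Prop :=
  [/\ set_fun (K n) (colors n) c,
      forall i, colors n i -> c i = i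
    & forall a, K n a -> set_inj (colors n) (fun i => c (i * a))].

Definition abelian_group_on (T : Type) (A : set T) (op : T -> T -> T) : Prop :=
  [/\ forall x y, A x -> A y -> A (op x y),
      forall x y z, A x -> A y -> A z -> op x (op y z) = op (op x y) z,
      forall x y, A x -> A y -> op x y = op y x
    & exists e, [/\ A e, forall x, A x -> op e x = x
        & forall x, A x -> exists2 y, A y & op y x = e]].

Definition multiplicative_coloring (n : nat) (c : nat -> nat) : Prop :=
  exists op : nat -> nat -> nat, abelian_group_on (colors n) op /\
    forall a b, K n a -> K n b -> c (a * b) = op (c a) (c b).

(* Main.v *)
Require Import Defs.
From mathcomp Require Import all_boot.
From mathcomp Require Import boolp classical_sets functions.
From mathcomp Require Import ssralg zmodp poly cyclic.

Set Implicit Arguments.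
Unset Strict Implicit.
Unset Printing Implicit Defensive.

Local Open Scope classical_set_scope.
Local Open Scope nat_scope.

(** Write p = k n + 1 and c a = a^k mod p. A member a of K n is prime to p,
    since its prime factors are at most n < p; hence, by Fermat,
    (c a)^n = a^(k n) = 1 modulo p, so c a is an n-th root of unity of the
    field of p elements. That field has at most n such roots, and the residues
    c 1, ..., c n are n distinct ones by the definition of a strong
    representative: they are therefore all of them
    ([power_residue_representative]). So c maps [colors n] bijectively onto
    c (K n), and the renaming psi is the inverse bijection.

    The coloring f = psi \o c then sends a to the unique color i with
    c i = c a. As c is multiplicative modulo p, the color of a product depends
    only on the colors of its factors, and x, y |-> f (x * y) is the group law
    transported from the n-th roots of unity
    ([multiplicative_coloring_of_retraction]). The colors of a, 2a, ..., na
    are distinct because c a is invertible modulo p. *)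

Lemma K_color (n i : nat) : colors n i -> K n i.
Proof.
move=> /= /andP[i_gt0 i_le]; apply/pnatP => // q _ q_dvd /=.
by rewrite !inE (leq_trans (dvdn_leq i_gt0 q_dvd) i_le).
Qed.

Lemma K_mul (n a b : nat) : K n a -> K n b -> K n (a * b).
Proof. by rewrite /K /= pnatM => -> ->. Qed.

Lemma K_exp (n a m : nat) : K n a -> K n (a ^ m).
Proof. by rewrite /K /= pnatX => ->. Qed.

Lemma K_coprime (n p a : nat) : prime p -> n < p -> K n a -> coprime a p.
Proof.
move=> p_prime n_lt_p Ka; rewrite coprime_sym prime_coprime //.
apply/negP => p_dvd_a.
have := pnat_dvd p_dvd_a Ka; rewrite pnatE // !inE.
by rewrite leqNgt n_lt_p.
Qed.

(** The group law is forced: since f fixes every color, f (x * y) is the only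
    candidate for the composite of x and y. Associativity and commutativity
    come from those of the product of integers, once f may be applied
    to a factor without changing the color of the product. *)
Lemma multiplicative_coloring_of_retraction (n : nat) (f : nat -> nat) :
    0 < n ->
    set_fun (K n) (colors n) f ->
    (forall i, colors n i -> f i = i) ->
    (forall a b, K n a -> K n b -> f (f a * b) = f (a * b)) ->
    (forall x, colors n x -> exists2 b, K n b & f (b * x) = 1) ->
  multiplicative_coloring n f.
Proof.
move=> n_gt0 f_color f_id f_absorb f_inv.
have color1 : colors n 1 by exact: n_gt0.
exists (fun x y => f (x * y)); split.
  split=> [x y /K_color Kx /K_color Ky|x y z /K_color Kx /K_color Ky /K_color Kz
          |x y _ _|].
  - exact/f_color/K_mul.
  - rewrite [x * f _]mulnC (f_absorb _ _ (K_mul Ky Kz) Kx).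
    by rewrite (f_absorb _ _ (K_mul Kx Ky) Kz) mulnC mulnA.
  - by rewrite mulnC.
  exists 1; split=> // [x cx|x cx]; first by rewrite mul1n f_id.
  have [b Kb bx1] := f_inv x cx.
  by exists (f b); [exact: f_color | rewrite f_absorb //; exact: K_color].
move=> a b Ka Kb; rewrite (f_absorb _ _ Ka (K_color (f_color _ Kb))).
by rewrite [a * f b]mulnC (f_absorb _ _ Kb Ka) mulnC.
Qed.

Section PowerResidue.

Variables n k : nat.
Hypotheses (n_gt0 : 0 < n) (k_gt0 : 0 < k).
Local Notation p := (k * n + 1).
Hypothesis p_prime : prime p.
Local Notation c := (fun a : nat => a ^ k %% p).

Lemma power_residue_mul (a b : nat) : c (a * b) = c a * c b %% p.
Proof. by rewrite /= expnMn modnMm. Qed.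

Lemma power_residue_cancel (a i j : nat) :
  coprime a p -> c (i * a) = c (j * a) -> c i = c j.
Proof.
move=> a_p; rewrite /= !expnMn => /eqP.
have ak_p : coprime p (a ^ k) by rewrite coprime_sym coprimeXl.
wlog le_ij : i j / j ^ k <= i ^ k => [wl|].
  case/orP: (leq_total (j ^ k) (i ^ k)) => le; first exact: wl.
  by rewrite eq_sym => /(wl _ _ le).
rewrite eqn_mod_dvd ?leq_mul2r ?le_ij ?orbT // -mulnBl Gauss_dvdl //.
by rewrite -eqn_mod_dvd // => /eqP.
Qed.

Lemma power_residue_root (a : nat) : coprime a p -> a ^ (k * n) %% p = 1.
Proof.
move=> /Euler_exp_totient; rewrite totient_prime // addn1 /= => ->.
by rewrite modn_small // ltnS muln_gt0 k_gt0.
Qed.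

(** The polynomial X^n - 1 has at most n roots in 'F_p, so the n distinct
    roots c 1, ..., c n exhaust its roots, and c a is one of them. *)
Lemma power_residue_representative (a : nat) :
  set_inj (colors n) c -> coprime a p -> exists2 i, colors n i & c a = c i.
Proof.
move=> c_inj a_p.
pose root_of (b : nat) : 'F_p := ((b ^ k)%:R)%R.
have root_ofE b : nat_of_ord (root_of b) = c b by exact: val_Fp_nat.
have root_of_unity b : coprime b p -> (n.-unity_root (root_of b))%R.
  move=> b_p; apply/unity_rootP; rewrite -GRing.natrX -expnM.
  by apply: val_inj; rewrite /= val_Fp_nat // power_residue_root //
    -[1%R]/(1%:R)%R val_Fp_nat // modn_small // prime_gt1.
have color_mem i : i \in iota 1 n = (0 < i <= n) by rewrite mem_iota add1n ltnS.
have n_lt_p : n < p by rewrite addn1 ltnS leq_pmull.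
have /mem_unity_roots roots_all :
    all (n.-unity_root)%R [seq root_of i | i <- iota 1 n].
  apply/allP => _ /mapP[i + ->]; rewrite color_mem => ci.
  exact/root_of_unity/(K_coprime p_prime n_lt_p)/K_color.
have := root_of_unity a a_p.
rewrite -[(n.-unity_root)%R _]/(root_of a \in (n.-unity_root)%R) roots_all //.
- by case/mapP=> i; rewrite color_mem => ci /(congr1 val) /=;
    rewrite !root_ofE; exists i.
- rewrite map_inj_in_uniq ?iota_uniq // => i j; rewrite !color_mem => ci cj.
  by move=> /(congr1 val) /=; rewrite !root_ofE; apply: c_inj; rewrite in_setE.
- by rewrite size_map size_iota.
Qed.

End PowerResidue.

Theorem theorem1p9 (n k : nat) (n_gt0 : 0 < n) (k_gt0 : 0 < k)
    (hp : strong_representative n (k * n + 1)) :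
  let c := fun a : nat => a ^ k %% (k * n + 1) in
  exists psi : nat -> nat,
    [/\ set_bij (c @` K n) (colors n) psi,
        satisfactory_coloring n (psi \o c)
      & multiplicative_coloring n (psi \o c)].
Proof.
move=> c; have [p_prime [k' [_ k'E c_inj]]] := hp.
have {k'E} kE : k' = k.
  by apply/eqP; move/eqP: k'E; rewrite eqn_add2r eqn_pmul2r // eq_sym.
move: c_inj; rewrite {}kE => {k'} c_inj.
have K_p a : K n a -> coprime a (k * n + 1).
  by apply: K_coprime => //; rewrite addn1 ltnS leq_pmull.
have c_repr a : K n a -> exists2 i, colors n i & c a = c i.
  by move=> /K_p; exact: power_residue_representative.
pose psi := 'pinv_(fun=> 0) (colors n) c.
have psiK i : colors n i -> psi (c i) = i.
  by move=> ci; apply: pinvKV c_inj _ _; rewrite in_setE.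
have psi_color a : K n a -> colors n (psi (c a)).
  by case/c_repr=> i ci ->; rewrite psiK.
have c_psi a : K n a -> c (psi (c a)) = c a.
  by case/c_repr=> i ci ->; rewrite psiK.
have c_mul a b : c (a * b) = c a * c b %% (k * n + 1).
  exact: power_residue_mul.
exists psi; split.
- split=> [_ [a Ka <-]|_ _ /set_mem[a Ka <-] /set_mem[b Kb <-] psi_ab|i ci].
  + exact: psi_color.
  + by rewrite -(c_psi a) // psi_ab c_psi.
  + by exists (c i); [exists i => //; exact: K_color | exact: psiK].
- split=> [||a Ka i j /set_mem ci /set_mem cj /= psi_ij].
  + exact: psi_color.
  + exact: psiK.
  apply: c_inj; rewrite ?in_setE //; apply: power_residue_cancel (K_p _ Ka) _.
  rewrite -/(c (i * a)) -/(c (j * a)) -(c_psi (i * a)).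
    by rewrite psi_ij c_psi //; exact/K_mul/Ka/K_color.
  exact/K_mul/Ka/K_color.
- apply: multiplicative_coloring_of_retraction => //= [a b Ka Kb|x cx].
  + by rewrite c_mul c_psi // -c_mul.
  (* The inverse of an n-th root of unity is its (n - 1)-th power. *)
  exists (x ^ n.-1); first exact/K_exp/K_color.
  rewrite -expnSr prednK // -[RHS](psiK 1 n_gt0) /c -expnM mulnC exp1n.
  rewrite power_residue_root ?modn_small ?prime_gt1 //.
  exact/K_p/K_color.
Qed.
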